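(* Every unilateral shift on a Banach space can be extended to a $\sigma$-shift of same multiplicity. That is, if $V$ is a unilateral shift on a complex Banach space $\mathbb{X}$ with closed generating subspace $\mathcal{L}$, then there exist a vector space $\mathbb{Y}$ with two complete norms $\|\cdot\|_\sigma,\|\cdot\|_{\mathbb{Y}}$, a $\sigma$-shift $\widetilde{V}:(\mathbb{Y},\|\cdot\|_\sigma)\to(\mathbb{Y},\|\cdot\|_{\mathbb{Y}})$ with a generating subspace $\mathcal{I}$ satisfying $\dim\mathcal{I}=\dim\mathcal{L}$, and a linear map $\iota:\mathbb{X}\to\mathbb{Y}$ that is isometric with respect to both $\|\cdot\|_\sigma$ and $\|\cdot\|_{\mathbb{Y}}$, such that $\widetilde{V}\iota=\iota V$.
   Context: All spaces are complex. $x\perp_B y$ in a normed space means $\|x+\lambda y\|\ge\|x\|$ for all $\lambda\in\mathbb{C}$; for subspaces it is required for all pairs of elements. Unilateral shift: an isometry $V:\mathbb{X}\to\mathbb{X}$ (linear, norm preserving) on a Banach space for which there is a subspace $\mathcal{L}\subseteq\mathbb{X}$ (the generating subspace) with $V^n\mathcal{L}\perp_B V^m\mathcal{L}$ for $n>m\ge 0$ and $\mathbb{X}=\bigoplus_{n=0}^\infty V^n\mathcal{L}$, i.e. every $x\in\mathbb{X}$ is uniquely a convergent series $x=\sum_{n=0}^\infty V^nl_n$ with $l_n\in\mathcal{L}$. Its multiplicity is $\dim\mathcal{L}$. $\sigma$-shift. Let $\mathbb{Y}$ be a vector space with two norms $\|\cdot\|_{\mathbb{Y}},\|\cdot\|_\sigma$,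 each making $\mathbb{Y}$ a Banach space. A surjective linear isometry $\widetilde{V}:(\mathbb{Y},\|\cdot\|_\sigma)\to(\mathbb{Y},\|\cdot\|_{\mathbb{Y}})$ is a $\sigma$-shift with generating subspace $\mathcal{I}$ (and multiplicity $\dim\mathcal{I}$) if: (i) $\mathcal{I}$ is a linear subspace of $\mathbb{Y}$, closed in both norms, such that $\widetilde{V}^n\mathcal{I}\perp_B\mathcal{I}$ for $n=1,2,\dots$ (with respect to $\|\cdot\|_{\mathbb{Y}}$) and $\mathcal{I}\perp_B\widetilde{V}^n\mathcal{I}$ for $n=-1,-2,\dots$ (with respect to $\|\cdot\|_\sigma$); (ii) $(\mathbb{Y},\|\cdot\|_{\mathbb{Y}})=(\mathbb{W},\|\cdot\|_{\mathbb{W}})$, where $\mathbb{W}=\{w_1+w_2: w_1\in\bigoplus_{n=0}^\infty\widetilde{V}^n\mathcal{I},\ w_2\in\bigoplus_{n=-\infty}^{-1}\widetilde{V}^n\mathcal{I}\}$ and $\|w_1+w_2\|_{\mathbb{W}}=(\|w_1\|_{\mathbb{Y}}^2+\|w_2\|_{\mathbb{Y}}^2)^{1/2}$. Here $\bigoplus_{n=0}^\infty\widetilde{V}^n\mathcal{I}$ (resp. $\bigoplus_{n=-\infty}^{-1}\widetilde{V}^n\mathcal{I}$) is the set of elements uniquely expressible as a series $\sum_{n=0}^\infty\widetilde{V}^nl_n$ (resp. $\sum_{n=1}^\infty\widetilde{V}^{-n}l_{-n}$), $l_n\in\mathcal{I}$, convergent in $\|\cdot\|_{\mathbb{Y}}$.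 *)

(* Defs.v *)
From HB Require Import structures.
From mathcomp Require Import all_boot all_order all_algebra.
From mathcomp Require Import complex.
From mathcomp Require Import all_classical all_reals.
From mathcomp Require Import topology normedtype sequences.

Set Implicit Arguments.
Unset Strict Implicit.
Unset Printing Implicit Defensive.

Import Order.TTheory GRing.Theory Num.Theory.
Import numFieldNormedType.Exports.

Local Open Scope classical_set_scope.
Local Open Scope ring_scope.
Local Open Scope complex_scope.

(* Norms take their values in the scalar field R[i], as in the library; the
   order of R[i] forces the values of a norm to be nonnegative reals. *)
Record norm_on (R : realType) (Y : lmodType R[i]) := NormOn {
  norm_fun :> Y -> R[i] ;
  norm_triangle : forall x y, norm_fun (x + y) <= norm_fun x + norm_fun y ;
  norm_homogeneous :
    forall (a : R[i]) x, norm_fun (a *: x) = `|a| * norm_fun x ;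
  norm_definite : forall x, norm_fun x = 0 -> x = 0 }.

(* An alias of Y which carries the norm N, so that several norms can be put on
   the same vector space. *)
Definition normed_by (R : realType) (Y : lmodType R[i]) (N : norm_on Y) : Type
  := Y.

HB.instance Definition _ (R : realType) (Y : lmodType R[i]) (N : norm_on Y) :=
  GRing.Lmodule.copy (normed_by N) Y.

HB.instance Definition _ (R : realType) (Y : lmodType R[i]) (N : norm_on Y) :=
  Lmodule_isNormed.Build R[i] (normed_by N)
    (@norm_triangle R Y N) (@norm_homogeneous R Y N)
    (@norm_definite R Y N).

Definition complete_norm (R : realType) (Y : lmodType R[i]) (N : norm_on Y) :=
  forall F : set_system (normed_by N), ProperFilter F -> cauchy F -> cvg F.

Definition subspace_set (R : realType) (E : lmodType R[i]) (A : set E) :=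
  submod_closed [in A].

Definition birkhoff_orthogonal (R : realType) (E : normedModType R[i])
    (A B : set E) :=
  forall x y, A x -> B y -> forall a : R[i], `|x| <= `|x + a *: y|.

(* The elements with a unique expansion \sum_n T_n l_n, l_n in L. *)
Definition series_sum (R : realType) (E : normedModType R[i])
    (T : nat -> E -> E) (L : set E) : set E :=
  [set x | exists! l : nat -> E,
     (forall n, L (l n)) /\ [series T n (l n)]_n @ \oo --> x].

Definition unilateral_shift (R : realType) (X : normedModType R[i])
    (V : {linear X -> X}) (L : set X) :=
  [/\ forall x, `|V x| = `|x|,
      subspace_set L,
      forall n m, (m < n)%N ->
        birkhoff_orthogonal (iter n V @` L) (iter m V @` L) &
      series_sum (fun n => iter n V) L = setT].

Definition linearly_independent (R : realType) (E : lmodType R[i])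
    (B : set E) :=
  forall (s : seq E) (c : E -> R[i]), uniq s -> {subset s <= B} ->
    \sum_(x <- s) c x *: x = 0 -> forall x, x \in s -> c x = 0.

Definition linear_span (R : realType) (E : lmodType R[i]) (B : set E) : set E
  := [set x | exists (s : seq E) (c : E -> R[i]),
       {subset s <= B} /\ x = \sum_(y <- s) c y *: y].

Definition basis_of_subspace (R : realType) (E : lmodType R[i]) (A B : set E)
  := linearly_independent B /\ linear_span B = A.

(* Dimension is the cardinality of a Hamel basis, possibly infinite; it does
   not depend on the basis. *)
Definition same_dimension (R : realType) (E F : lmodType R[i])
    (A : set E) (B : set F) :=
  exists (bA : set E) (bB : set F),
    [/\ basis_of_subspace A bA, basis_of_subspace B bB & (bA #= bB)%card].

(* 'pinv_ is an inverse of f on the range of f, hence the inverse of f when f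
   is bijective; the default value 0 is then irrelevant. *)
Definition ziter (E : zmodType) (f : E -> E) (n : int) : E -> E :=
  match n with
  | Posz k => iter k f
  | Negz k => iter k.+1 ('pinv_(fun=> 0) setT f)
  end.

(* Nsigma is the norm of the domain of V and NY the norm of its codomain; being
   isometric, V is injective. *)
Definition sigma_shift (R : realType) (Y : lmodType R[i])
    (Nsigma NY : norm_on Y) (V : {linear Y -> Y}) (I : set Y) :=
  let Ypos : set Y :=
    @series_sum R (normed_by NY) (fun n => ziter V n%:Z) I in
  let Yneg : set Y :=
    @series_sum R (normed_by NY) (fun n => ziter V (- n.+1%:Z)) I in
  [/\ complete_norm Nsigma /\ complete_norm NY,
      (forall y, NY (V y) = Nsigma y) /\ set_surj setT setT V,
      [/\ subspace_set I,
          closed (I : set (normed_by Nsigma)),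
          closed (I : set (normed_by NY)),
          forall n : int, 0 < n ->
            @birkhoff_orthogonal R (normed_by NY) (ziter V n @` I) I &
          forall n : int, n < 0 ->
            @birkhoff_orthogonal R (normed_by Nsigma) I (ziter V n @` I)] &
      [set w1 + w2 | w1 in Ypos & w2 in Yneg] = setT /\
      (forall w1 w2, Ypos w1 -> Yneg w2 ->
         NY (w1 + w2) = sqrtC (NY w1 ^+ 2 + NY w2 ^+ 2))].

(* Main.v *)
Require Import Defs.
From HB Require Import structures.
From mathcomp Require Import all_boot all_order all_algebra.
From mathcomp Require Import complex.
From mathcomp Require Import all_classical all_reals.
From mathcomp Require Import topology normedtype sequences.

Set Implicit Arguments.
Unset Strict Implicit.
Unset Printing Implicit Defensive.

Import Order.TTheory GRing.Theory Num.Theory.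
Import numFieldNormedType.Exports.

Local Open Scope classical_set_scope.
Local Open Scope ring_scope.
Local Open Scope complex_scope.

(** Every x in X splits uniquely as V (S x) + P x with P x in L: this is the
expansion of x with its term in L set apart.  On X * X with the l2-norm the
map D (x, z) = (V x + P z, S z) is bijective with inverse
(x, z) |-> (S x, V z + P x), and it extends V on X * 0.  The negative half of
the shift is a second copy of X: for l in L, D^-(n+1) (l, 0) = (0, V^n l), so
that both series spaces are isometric copies of the expansions of X.  The
sigma-norm is the l2-norm pulled back along D. *)

(** * Linear isometries: Cauchy filters, closed images and series expansions *)

Section Isometry.
Variables (K : numFieldType) (E F : normedModType K) (f : {linear E -> F}).
Hypothesis isof : forall x, `|f x| = `|x|.

Lemma isometry_inj : injective f.
Proof.
move=> x y fxy; apply/eqP; rewrite -subr_eq0 -normr_eq0 -isof linearB fxy.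
by rewrite subrr normr0.
Qed.

Lemma isometry_dist x y : `|f x - f y| = `|x - y|.
Proof. by rewrite -linearB isof. Qed.

Lemma isometry_cvg (T : Type) (G : set_system T) (FG : Filter G) (u : T -> E)
    (x : E) :
  (f \o u @ G --> f x) <-> (u @ G --> x).
Proof.
split=> /cvgrPdist_lt cvgu; apply/cvgrPdist_lt => e /cvgu;
  by apply: filterS => t /=; rewrite isometry_dist.
Qed.

Lemma isometry_cauchy (G : set_system E) (FG : Filter G) :
  cauchy (f @ G) <-> cauchy G.
Proof.
have ballf x y e : ball (f x) e (f y) = ball x e y.
  by rewrite -!ball_normE /= isometry_dist.
split=> /cauchy_ballP cG; apply/cauchy_ballP => e /cG;
  rewrite !near_simpl/=; rewrite !near_map2; apply: filterS => -[x y] /=;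
  by rewrite ballf.
Qed.

End Isometry.
(** The image of a Cauchy filter converges in [F], and surjectivity brings its limit back to [E].
    This yields the completeness of the pulled-back sigma-norm. *)
Lemma isometry_complete (K : numFieldType) (E F : normedModType K)
    (f : {linear E -> F}) (isof : forall x, `|f x| = `|x|)
    (surjf : forall y, exists x, f x = y)
    (complF : forall G : set_system F, ProperFilter G -> cauchy G -> cvg G)
    (G : set_system E) :
  ProperFilter G -> cauchy G -> cvg G.
Proof.
move=> PG cG; have cfG : cauchy (f @ G) by exact/isometry_cauchy.
have /cvg_ex[y] := complF _ (fmap_proper_filter f PG) cfG.
have [x <-] := surjf y => /(isometry_cvg isof _ id) Gx; apply/cvg_ex.
by exists x.
Qed.

Lemma isometry_closed_image (K : numFieldType) (E : completeNormedModType K)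
    (F : normedModType K) (f : {linear E -> F})
    (isof : forall x, `|f x| = `|x|) (A : set E) :
  closed A -> closed (f @` A).
Proof.
move=> closedA y cly.
(* The traces on [A] of the preimages of neighbourhoods of [y]: the image of [G] tends to [y], so
   [G] is Cauchy and converges in the complete space [E]. *)
pose G := filter_from (nbhs y) (fun B => A `&` f @^-1` B).
have FG : Filter G.
  apply: filter_from_filter; first by exists setT; exact: filterT.
  move=> B C yB yC; exists (B `&` C); first exact: filterI.
  by move=> x [Ax [Bx Cx]].
have PG : ProperFilter G.
  apply: filter_from_proper => B yB.
  by have [_ [[x Ax <-] Bx]] := cly B yB; exists x.
have fGy : f @ G --> y by move=> B yB; exists B => // x [].
have /cauchy_cvg/cvg_ex[x Gx] : cauchy G.
  by apply/(isometry_cauchy isof); apply: cvg_cauchy; apply/cvg_ex; exists y.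
exists x; last first.
  apply: cvg_unique fGy; first exact: norm_hausdorff.
  exact/(isometry_cvg isof _ id).
apply: (closed_cvg (F := G) (u_ := id) A) => //.
by exists setT => [|z []//]; exact: filterT.
Qed.

(** Coefficients are carried by [g] and sums by [f]; the two differ for the negative half of the
    shift, whose coefficients and sums lie in different copies of [X]. *)
Lemma series_sum_isometry (R : realType) (E : completeNormedModType R[i])
    (F : normedModType R[i]) (f : {linear E -> F})
    (isof : forall x, `|f x| = `|x|) (g : E -> F) (injg : injective g)
    (T : nat -> E -> E) (T' : nat -> F -> F) (L : set E) :
  (forall n l, L l -> T' n (g l) = f (T n l)) ->
  series_sum T' (g @` L) = f @` series_sum T L.
Proof.
move=> fT.
have fseries l : (forall n, L (l n)) ->
    [series T' n (g (l n))]_n = f \o [series T n (l n)]_n.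
  move=> Ll; apply/funext => n; rewrite /= !seriesEnat /= linear_sum.
  by apply: eq_bigr => i _; rewrite fT.
apply/seteqP; split=> [y [l' [[Ll' cvgl'] uniql']]|
    _ [x [l [[Ll cvgl] uniql]] <-]].
  have /choice[l /all_and2[Ll gl]] : forall n, exists l, L l /\ g l = l' n.
    by move=> n; have [l] := Ll' n; exists l.
  have El' : l' = g \o l by apply/funext => n; rewrite /= gl.
  rewrite El' (fseries l Ll) in cvgl'.
  (* The partial sums lie in the range of [f], which is closed because [E] is complete; hence so
     does their limit. *)
  have : (range f) y.
    apply: (closed_cvg _ (isometry_closed_image isof closedT)) cvgl'.
    by near=> n; exists ([series T n (l n)]_n n).
  move=> [x _ fxy]; exists x => //; exists l; split.
    by split=> //; apply/(isometry_cvg isof); rewrite fxy.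
  move=> m [Lm cvgm]; have : l' = g \o m.
    apply: uniql'; split=> [n|]; first by exists (m n).
    by rewrite (fseries m Lm) -fxy; apply/(isometry_cvg isof).
  rewrite El' => /funeqP glm; apply/funext => n.
  by apply: injg; apply: glm.
exists (g \o l); split.
  split=> [n|]; first by exists (l n).
  by rewrite (fseries l Ll); apply/(isometry_cvg isof).
move=> m' [Lm' cvgm'].
have /choice[m /all_and2[Lm gm]] : forall n, exists m, L m /\ g m = m' n.
  by move=> n; have [m] := Lm' n; exists m.
have Em' : m' = g \o m by apply/funext => n; rewrite /= gm.
rewrite Em' (fseries m Lm) in cvgm' *.
by rewrite (uniql m) //; split=> //; apply/(isometry_cvg isof).
Unshelve. all: by end_near. Qed.

(** * Hamel bases and their transport along injective linear maps *)

Section HamelBasis.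
Variables (R : realType) (E : lmodType R[i]).

Lemma subspace_sum (A : set E) (s : seq E) (c : E -> R[i]) :
  subspace_set A -> {subset s <= A} -> A (\sum_(x <- s) c x *: x).
Proof.
move=> [A0 lA]; elim: s => [|x s IH] sA.
  by rewrite big_nil; apply: set_mem.
rewrite big_cons; apply: set_mem; apply: lA.
  by apply: sA; rewrite mem_head.
by rewrite inE; apply: IH => y ys; apply: sA; rewrite in_cons ys orbT.
Qed.

(** By Zorn's lemma there is a maximal independent subset of [A]; a vector of [A] outside its span
    could be added to it. *)
Lemma basis_exists (A : set E) :
  subspace_set A -> exists B, basis_of_subspace A B.
Proof.
move=> sA.
pose P (B : set E) := B `<=` A /\ linearly_independent B.
have [|B [[BA freeB] maxB]] := @Zorn_bigcup _ P.
  move=> F FP totF; split; first by move=> x [B /FP[BA _] /BA].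
  move=> s c us sF; have [B [PB sB]] : exists B, P B /\ {subset s <= B}.
    (* The chain may be empty, so the empty list is served by [set0] instead of a member of the
       chain. *)
    case: s us sF => [|x0 s0] us sF.
      exists set0; split=> //; split=> // s d us' s0 _ x /s0.
      by rewrite inE.
    (* Induction over sublists: [x0] supplies a member of the chain for the empty one, and at each
       further vector the larger of two members is kept. *)
    have : forall t : seq E, {subset t <= x0 :: s0} ->
        exists2 B, F B & {subset t <= B}.
      elim=> [|x t IH] tF.
        by have := sF x0 (mem_head _ _); rewrite inE => -[B FB _]; exists B.
      have [y yt|B FB tB] := IH; first by apply: tF; rewrite in_cons yt orbT.
      have := sF x (tF _ (mem_head _ _)); rewrite inE => -[C FC Cx].
      have [BC|CB] := totF _ _ FB FC.
        exists C => // y; rewrite in_cons => /orP[/eqP->|/tB]; rewrite !inE //.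
        exact: BC.
      exists B => // y; rewrite in_cons => /orP[/eqP->|/tB //].
      by rewrite inE; exact: CB.
    by move=> /(_ _ (fun _ => id))[B FB sB]; exists B; split => //; exact: FP.
  exact: PB.2 _ us sB.
exists B; split=> //; apply/seteqP; split.
  move=> _ [s [c [sB ->]]]; apply: subspace_sum => // x /sB.
  by rewrite !inE; exact: BA.
move=> a Aa; apply: contrapT => spana; apply: (maxB (a |` B)).
  split; first by move=> x; right.
  move=> /(_ a (or_introl erefl)) Ba; apply: spana.
  exists [:: a], (fun=> 1); rewrite big_seq1 scale1r; split=> // x.
  by rewrite mem_seq1 inE => /eqP ->.
split; first by move=> x [-> //|]; exact: BA.
move=> s c us saB sum0.
have remB : {subset rem a s <= B}.
  move=> x; rewrite mem_rem_uniq // inE => /andP[xa /saB].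
  by rewrite !inE => -[xa'|//]; move: xa; rewrite xa' eqxx.
have ca0 : a \in s -> c a = 0.
  move=> sa; apply: contrapT => /eqP ca; apply: spana.
  exists (rem a s), (fun y => - (c a)^-1 * c y); split=> //.
  under eq_bigr do rewrite -scalerA.
  rewrite -scaler_sumr; move: sum0; rewrite (big_rem a) //=.
  move/eqP; rewrite addr_eq0 => /eqP/(congr1 ( *:%R (c a)^-1)).
  by rewrite scalerA mulVf // scale1r scalerN scaleNr.
move=> x sx; have [xa|xa] := eqVneq x a; first by rewrite xa ca0 // -xa.
apply: (freeB (rem a s) c) => //; first exact: rem_uniq.
  have [sa|sa] := boolP (a \in s).
    by move: sum0; rewrite (big_rem a) //= (ca0 sa) scale0r add0r.
  by rewrite rem_id.
by rewrite mem_rem_uniq // inE xa.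
Qed.

End HamelBasis.

Lemma basis_of_image (R : realType) (E F : lmodType R[i])
    (f : {linear E -> F}) (injf : injective f) (A B : set E) :
  basis_of_subspace A B -> basis_of_subspace (f @` A) (f @` B).
Proof.
move=> [freeB <-].
have lift (s : seq F) : {subset s <= f @` B} ->
    exists2 t : seq E, s = map f t & {subset t <= B}.
  elim: s => [|y s IH] sB; first by exists [::].
  have [z zs|t -> tB] := IH; first by apply: sB; rewrite in_cons zs orbT.
  have := sB y (mem_head _ _); rewrite inE => -[x Bx <-].
  exists (x :: t) => // z; rewrite in_cons => /orP[/eqP ->|/tB //].
  by rewrite inE.
split.
  move=> s c us sfB; have [t st tB] := lift _ sfB; rewrite {}st in us *.
  rewrite big_map => sum0 y /mapP[x xt ->].
  apply: (freeB t (c \o f)) => //; first by rewrite map_inj_uniq in us.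
  apply: injf; rewrite linear_sum linear0 -[RHS]sum0.
  by apply: eq_bigr => z _; rewrite linearZ.
apply/seteqP; split=> [y [s [c [sfB ->]]]|_ [_ [s [c [sB ->]]] <-]].
  have [t -> tB] := lift _ sfB; exists (\sum_(x <- t) c (f x) *: x).
    by exists t, (c \o f).
  by rewrite linear_sum big_map; apply: eq_bigr => z _; rewrite linearZ.
(* A left inverse [g] of [f], with junk value [0] off the range, turns coefficients on [E] into
   coefficients on [F]. *)
have /choice[g gf] : forall y, exists x, (exists x, f x = y) -> f x = y.
  by move=> y; have [[x <-]|] := pselect (exists x, f x = y);
    [exists x | exists 0].
have fK x : g (f x) = x by apply: injf; apply: gf; exists x.
exists (map f s), (c \o g); split.
  by move=> y /mapP[x /sB]; rewrite !inE => Bx ->; exists x.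
by rewrite linear_sum big_map; apply: eq_bigr => z _; rewrite /= fK linearZ.
Qed.

Lemma same_dimension_image (R : realType) (E F : lmodType R[i])
    (f : {linear E -> F}) (injf : injective f) (A : set E) :
  subspace_set A -> same_dimension (f @` A) A.
Proof.
move=> /basis_exists[B AB]; exists (f @` B), B; split=> //.
  exact: basis_of_image.
by apply: inj_card_eq; exact: in2W.
Qed.

Lemma subspace_image (R : realType) (E F : lmodType R[i])
    (f : {linear E -> F}) (A : set E) :
  subspace_set A -> subspace_set (f @` A).
Proof.
move=> [A0 lA]; split.
  by rewrite inE; exists 0; [exact: set_mem|exact: linear0].
move=> a _ _ /set_mem[x Ax <-] /set_mem[y Ay <-]; apply/mem_set.
by exists (a *: x + y); [apply/set_mem/lA; exact: mem_set|rewrite linearP].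
Qed.

(** * Norms pulled back along injections, and the l2-norm on pairs *)

Section PullbackNorm.
Variables (R : realType) (E F : lmodType R[i]) (N : norm_on F).
Variables (f : {linear E -> F}) (injf : injective f).

Let pullback_triangle x y : N (f (x + y)) <= N (f x) + N (f y).
Proof. by rewrite linearD norm_triangle. Qed.

Let pullback_homogeneous (a : R[i]) x : N (f (a *: x)) = `|a| * N (f x).
Proof. by rewrite linearZ norm_homogeneous. Qed.

Let pullback_definite x : N (f x) = 0 -> x = 0.
Proof. by move=> /norm_definite fx0; apply: injf; rewrite fx0 linear0. Qed.

Definition pullback_norm : norm_on E :=
  NormOn pullback_triangle pullback_homogeneous pullback_definite.

End PullbackNorm.

Section HilbertSum.
Variables (R : realType) (X : normedModType R[i]).

Let l2 (x : X * X) : R[i] := sqrtC (`|x.1| ^+ 2 + `|x.2| ^+ 2).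

(** Reading the l2-norm as the modulus of a complex number reduces its triangle inequality to the
    one for scalars. *)
Let l2E x : l2 x = `| `|x.1| + 'i%R * `|x.2| |.
Proof.
by rewrite /l2 -normC2_rect ?realE ?normr_ge0 // sqrCK.
Qed.

Let l2_le (x : X * X) (a b : R[i]) : `|x.1| <= a -> `|x.2| <= b ->
  l2 x <= `|a + 'i%R * b|.
Proof.
move=> xa xb; have a0 := le_trans (normr_ge0 _) xa.
have b0 := le_trans (normr_ge0 _) xb.
rewrite -[leRHS]sqrCK // normC2_rect ?realE ?a0 ?b0 // ler_sqrtC ?nnegrE;
  by rewrite ?addr_ge0 ?exprn_ge0 // lerD // lerXn2r ?nnegrE.
Qed.

Let l2_triangle x y : l2 (x + y) <= l2 x + l2 y.
Proof.
have := @l2_le (x + y) _ _ (ler_normD x.1 y.1) (ler_normD x.2 y.2).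
move/le_trans; apply.
by rewrite !l2E mulrDr addrACA ler_normD.
Qed.

Let l2_homogeneous (a : R[i]) x : l2 (a *: x) = `|a| * l2 x.
Proof. by rewrite !l2E /= !normrZ mulrCA -mulrDr normrM normr_id. Qed.

Let l2_definite x : l2 x = 0 -> x = 0.
Proof.
move/eqP; rewrite sqrtC_eq0 paddr_eq0 ?exprn_ge0 // !expf_eq0 /= !normr_eq0.
by case: x => x1 x2 /= /andP[/eqP-> /eqP->].
Qed.

Definition l2_norm : norm_on (X * X)%type :=
  NormOn l2_triangle l2_homogeneous l2_definite.

Lemma l2_normE x : l2_norm x = sqrtC (`|x.1| ^+ 2 + `|x.2| ^+ 2).
Proof. by []. Qed.

Lemma norm_fst_le x : `|x.1| <= l2_norm x.
Proof.
rewrite l2_normE -[leLHS]sqrCK // ler_sqrtC ?nnegrE ?addr_ge0 ?exprn_ge0 //.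
by rewrite lerDl exprn_ge0.
Qed.

Lemma norm_snd_le x : `|x.2| <= l2_norm x.
Proof.
rewrite l2_normE -[leLHS]sqrCK // ler_sqrtC ?nnegrE ?addr_ge0 ?exprn_ge0 //.
by rewrite lerDr exprn_ge0.
Qed.

Lemma l2_norm_le_add x : l2_norm x <= `|x.1| + `|x.2|.
Proof.
rewrite [leLHS]l2E (le_trans (ler_normD _ _)) // normrM !normr_id.
by rewrite normCi mul1r.
Qed.

Definition inl0 (x : X) : X * X := (x, 0).

Fact inl0_is_linear : linear inl0.
Proof. by move=> a x y; congr pair; rewrite /= scaler0 addr0. Qed.

HB.instance Definition _ :=
  GRing.isLinear.Build R[i] X (X * X)%type _ inl0 inl0_is_linear.

Definition inr0 (x : X) : X * X := (0, x).

Fact inr0_is_linear : linear inr0.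
Proof. by move=> a x y; congr pair; rewrite /= scaler0 addr0. Qed.

HB.instance Definition _ :=
  GRing.isLinear.Build R[i] X (X * X)%type _ inr0 inr0_is_linear.

Lemma l2_norm_inl0 x : l2_norm (inl0 x) = `|x|.
Proof. by rewrite l2_normE /= normr0 expr0n addr0 sqrCK. Qed.

Lemma l2_norm_inr0 x : l2_norm (inr0 x) = `|x|.
Proof. by rewrite l2_normE /= normr0 expr0n add0r sqrCK. Qed.

End HilbertSum.

(** Each coordinate is bounded by the l2-norm, so a Cauchy filter converges coordinatewise; the
    l2-norm is bounded by the sum of the coordinate norms, so the pair of limits is the limit. *)
Lemma l2_norm_complete (R : realType) (X : completeNormedModType R[i]) :
  complete_norm (l2_norm X).
Proof.
move=> G PG /cauchy_ballP cG.
have cauchy_coord (p : {linear (X * X)%type -> X}) :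
    (forall x, `|p x| <= l2_norm X x) -> cauchy (p @ G).
  move=> lep; apply/cauchy_ballP => e /cG; rewrite !near_simpl/= near_map2.
  apply: filterS => -[x y] /=; rewrite -!ball_normE /= -linearB.
  exact: le_lt_trans.
have /cauchy_cvg/cvg_ex[x1 Gx1] := cauchy_coord fst (@norm_fst_le _ _).
have /cauchy_cvg/cvg_ex[x2 Gx2] := cauchy_coord snd (@norm_snd_le _ _).
apply/cvg_ex; exists (x1, x2); apply/(@cvgrPdist_lt _ _ _ _ _ id) => e e0.
have e20 : 0 < e / 2 by rewrite divr_gt0.
move/cvgrPdist_lt : Gx1 => /(_ _ e20) Gx1.
move/cvgrPdist_lt : Gx2 => /(_ _ e20) Gx2.
near=> y; apply: le_lt_trans (l2_norm_le_add _) _.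
rewrite [ltRHS]splitr; apply: ltrD; by [near: y|near: y].
Unshelve. all: by end_near. Qed.

(** * The splitting of [X] into the range of [V] and [L] *)

Section WoldDecomposition.
Variables (R : realType) (X : completeNormedModType R[i]).
Variables (V : {linear X -> X}) (L : set X).
Hypothesis shiftV : unilateral_shift V L.

Let isoV : forall x, `|V x| = `|x|. Proof. by case: shiftV. Qed.

Let series_shift (l : nat -> X) n :
  [series iter k V (l k)]_k n.+1 = l 0 + V ([series iter k V (l k.+1)]_k n).
Proof.
rewrite !seriesEnat /= big_nat_recl // linear_sum; congr (_ + _).
Qed.

(** Once the term [l 0] is removed, the partial sums of the expansion of [x] lie in the range of
    [V], which is closed since [V] is an isometry of a complete space. *)
Lemma shift_decomposition x : exists y l, L l /\ x = V y + l.
Proof.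
have [_ _ _ expand] := shiftV.
have : series_sum (fun n => iter n V) L x by rewrite expand.
move=> [l [[Ll cvgl] _]].
have [y _ Vy] : range V (x - l 0).
  apply: (closed_cvg (F := \oo)
    (u_ := fun n => [series iter k V (l k)]_k n.+1 - l 0) _
    (isometry_closed_image isoV closedT)).
    near=> n; exists ([series iter k V (l k.+1)]_k n) => //.
    by rewrite series_shift addrAC subrr add0r.
  apply: cvgB; [by rewrite cvg_shiftS|exact: cvg_cst].
by exists y, (l 0); rewrite Vy subrK.
Unshelve. all: by end_near. Qed.

(** Putting [l] in front of the coefficients of [y] gives an expansion of [V y + l], that is of [0],
    and such an expansion is unique. *)
Lemma shift_decomposition0 y l : L l -> V y + l = 0 -> y = 0 /\ l = 0.
Proof.
move=> Ll Vyl; suff l0 : l = 0.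
  move: Vyl; rewrite l0 addr0 => Vy0; split=> //.
  by apply: (isometry_inj isoV); rewrite Vy0 linear0.
have [_ [L0 _] _ expand] := shiftV.
have : series_sum (fun n => iter n V) L y by rewrite expand.
move=> [k [[Lk cvgk] _]].
have : series_sum (fun n => iter n V) L 0 by rewrite expand.
move=> [z [_ uniqz]].
pose m n := if n is n'.+1 then k n' else l.
have -> : l = m 0 by [].
rewrite -(uniqz m); last first.
  split; first by case.
  rewrite -cvg_shiftS -Vyl addrC.
  under eq_fun do rewrite series_shift.
  by apply: cvgD; [exact: cvg_cst|exact/(isometry_cvg isoV)].
(* The zero sequence expands [0] as well, so [z] vanishes, and with it [l]. *)
rewrite (uniqz (fun=> 0)) //; split=> [n|]; first exact: set_mem.
rewrite (_ : [series _]_n = fun=> 0); first exact: cvg_cst.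
apply/funext => n; rewrite seriesEnat /= big1 // => i _.
by elim: i => //= i ->; rewrite linear0.
Qed.

(** [S] is the backward shift and [P] the projection onto [L] along the range of [V]. Both are
    chosen pointwise; uniqueness of the splitting makes them linear. *)
Lemma wold_decomposition : exists P S : {linear X -> X},
  [/\ forall x, L (P x), forall x, V (S x) + P x = x, cancel V S,
      forall x, P (V x) = 0 & forall l, L l -> P l = l /\ S l = 0].
Proof.
have [_ [L0 lL] _ _] := shiftV.
have uniq_dec y l y' l' : L l -> L l' -> V y + l = V y' + l' ->
    y = y' /\ l = l'.
  move=> Ll Ll' /eqP; rewrite -subr_eq0 opprD addrACA -linearB => /eqP e0.
  have [|/eqP + /eqP] := shift_decomposition0 _ e0; last first.
    by rewrite !subr_eq0 => /eqP-> /eqP->.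
  rewrite -scaleN1r addrC; apply: set_mem; apply: lL; exact: mem_set.
have /choice[s /choice[p /all_and2[Lp sp]]] := shift_decomposition.
have spE x : V (s x) + p x = x by exact/esym/sp.
have linsp a x y : s (a *: x + y) = a *: s x + s y /\
    p (a *: x + y) = a *: p x + p y.
  apply: uniq_dec => //; first by apply: set_mem; apply: lL; exact: mem_set.
  by rewrite linearP addrACA -scalerDr !spE.
pose P : {linear X -> X} := HB.pack p
  (GRing.isLinear.Build R[i] X X _ p (fun a x y => (linsp a x y).2)).
pose S : {linear X -> X} := HB.pack s
  (GRing.isLinear.Build R[i] X X _ s (fun a x y => (linsp a x y).1)).
have spV x : s (V x) = x /\ p (V x) = 0.
  by apply: uniq_dec; rewrite ?spE ?addr0 //; exact: set_mem.
exists P, S; split=> //=.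
- by move=> x; have [] := spV x.
- by move=> x; have [] := spV x.
- move=> l Ll; have [] : s l = 0 /\ p l = l; last by [].
  by apply: uniq_dec => //; rewrite spE linear0 add0r.
Qed.

End WoldDecomposition.

(** * The bijective extension of [V] to pairs *)

Section Dilation.
Variables (R : realType) (X : lmodType R[i]) (V P S : {linear X -> X}).

Definition dilation (y : X * X) : X * X := (V y.1 + P y.2, S y.2).

Fact dilation_is_linear : linear dilation.
Proof.
move=> a x y; rewrite /dilation /= !linearP; congr pair.
by rewrite /= scalerDr addrACA.
Qed.

HB.instance Definition _ :=
  GRing.isLinear.Build R[i] (X * X)%type (X * X)%type _ dilation
    dilation_is_linear.

Definition dilation_inv (y : X * X) : X * X := (S y.1, V y.2 + P y.1).

Hypotheses (VSP : forall x, V (S x) + P x = x) (VK : cancel V S)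
  (PV : forall x, P (V x) = 0) (PP : forall x, P (P x) = P x)
  (SP : forall x, S (P x) = 0).

(** [S] and [P] recover [x] and [P z] from the first coordinate [V x + P z]; the second coordinate
    [S z] then completes [z = V (S z) + P z]. *)
Lemma dilationK : cancel dilation dilation_inv.
Proof.
case=> x z; rewrite /dilation /dilation_inv /= !linearD /=.
by rewrite VK SP PV PP addr0 add0r VSP.
Qed.

Lemma dilation_invK : cancel dilation_inv dilation.
Proof.
case=> x z; rewrite /dilation /dilation_inv /= !linearD /=.
by rewrite VK SP PV PP addr0 add0r VSP.
Qed.

Lemma pinv_dilation : 'pinv_(fun=> 0) setT dilation = dilation_inv.
Proof.
apply/funext => y; rewrite -{1}(dilation_invK y) pinvKV ?inE //.
by move=> u v _ _; exact: can_inj dilationK u v.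
Qed.

End Dilation.

Theorem theorem6p7 (R : realType) (X : completeNormedModType R[i])
    (V : {linear X -> X}) (L : set X)
    (closedL : closed L) (shiftV : unilateral_shift V L) :
  exists (Y : lmodType R[i]) (Nsigma NY : norm_on Y)
    (Vtilde : {linear Y -> Y}) (I : set Y) (iota : {linear X -> Y}),
    [/\ sigma_shift Nsigma NY Vtilde I,
        same_dimension I L,
        forall x, Nsigma (iota x) = `|x| /\ NY (iota x) = `|x| &
        forall x, Vtilde (iota x) = iota (V x)].
Proof.
have [isoV subL orthoV expandV] := shiftV.
have [P [S [LP VSP VK PV PSL]]] := wold_decomposition shiftV.
have PP x : P (P x) = P x by have [] := PSL _ (LP x).
have SP x : S (P x) = 0 by have [] := PSL _ (LP x).
pose D : {linear (X * X)%type -> (X * X)%type} := dilation V P S.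
have DK := dilationK VSP VK PV PP SP.
have injD : injective D := can_inj DK.
have DKV := dilation_invK VSP VK PV PP SP.
have pinvD := pinv_dilation VSP VK PV PP SP.
pose NY := l2_norm X; pose Ns := pullback_norm NY injD.
have D_inl x : D (inl0 x) = inl0 (V x).
  by rewrite /D /= /dilation /inl0 /= !linear0 addr0.
have Ns_inl x : Ns (inl0 x) = `|x|.
  by rewrite -[LHS]/(NY (D (inl0 x))) D_inl l2_norm_inl0 isoV.
have iter_pos n x : ziter D n%:Z (inl0 x) = inl0 (iter n V x).
  by elim: n => //= n ->; exact: D_inl.
(* The first inverse step only moves [l] to the second copy, since [P l = l] and [S l = 0]; each
   later one applies [V] there. Hence the power [n] for the index [-(n+1)]. *)
have iter_neg n l : L l -> ziter D (- n.+1%:Z) (inl0 l) = inr0 (iter n V l).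
  move=> Ll; rewrite -NegzE /= pinvD; elim: n => [|n IH].
    by have [Pl Sl] := PSL _ Ll; rewrite /dilation_inv /= Pl Sl linear0 add0r.
  by rewrite iterS IH /dilation_inv /= !linear0 addr0.
(* The embeddings are retyped into the aliases so that each isometry statement refers to the
   intended norm. *)
pose inlY : {linear X -> normed_by NY} := @inl0 R X.
pose inrY : {linear X -> normed_by NY} := @inr0 R X.
pose inlS : {linear X -> normed_by Ns} := @inl0 R X.
have iso_inlY x : `|inlY x| = `|x| by exact: l2_norm_inl0.
have iso_inrY x : `|inrY x| = `|x| by exact: l2_norm_inr0.
have iso_inlS x : `|inlS x| = `|x| by exact: Ns_inl.
pose DY : {linear normed_by Ns -> normed_by NY} := D.
exists (X * X)%type, Ns, NY, D, (@inl0 R X @` L), (@inl0 R X); split=> //.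
- have YposE : @series_sum R (normed_by NY) (fun n => ziter D n%:Z)
      (@inl0 R X @` L) = range (@inl0 R X).
    rewrite -expandV; apply: (series_sum_isometry (f := inlY)) => //.
    exact: (isometry_inj iso_inlY).
  have YnegE : @series_sum R (normed_by NY) (fun n => ziter D (- n.+1%:Z))
      (@inl0 R X @` L) = range (@inr0 R X).
    (* The sums lie in the second copy, but the coefficients still come from [inl0], whose
       injectivity is the remaining goal. *)
    rewrite -expandV; apply: (series_sum_isometry (f := inrY)) => //.
    exact: (isometry_inj iso_inlY).
  split.
  + split; last exact: l2_norm_complete.
    apply: (isometry_complete (f := DY)) => //; last exact: l2_norm_complete.
    by move=> y; exists (dilation_inv V P S y); exact: DKV.
  + by split=> // y _; exists (dilation_inv V P S y) => //; exact: DKV.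
  + split.
    * exact: subspace_image.
    * exact: (isometry_closed_image iso_inlS).
    * exact: (isometry_closed_image iso_inlY).
    * case=> // -[//|n] _ _ _ [_ [l Ll <-] <-] [l' Ll' <-] a.
      rewrite iter_pos -[inl0 (iter _ _ _)]/(inlY _) -[inl0 l']/(inlY l').
      rewrite -linearZ -linearD !iso_inlY.
      by apply: (orthoV n.+1 0%N) => //; [exists l|exists l'].
    * case=> // n _ _ _ [l Ll <-] [_ [l' Ll' <-] <-] a.
      rewrite NegzE iter_neg // -[inl0 l]/(inlS l) iso_inlS.
      apply: le_trans (norm_fst_le (D (inl0 l + a *: inr0 (iter n V l')))).
      (* D (0, z) has first coordinate P z in L, and V L is orthogonal to L. *)
      rewrite linearD linearZ D_inl /= linear0 add0r -[leLHS]isoV.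
      apply: (orthoV 1%N 0%N) => //; [by exists l|].
      by exists (P (iter n V l')).
  + rewrite YposE YnegE; split.
      apply/seteqP; split=> // -[x z] _.
      exists (inl0 x); first by exists x.
      exists (inr0 z); first by exists z.
      by congr pair; rewrite /= ?addr0 ?add0r.
    move=> _ _ [x _ <-] [z _ <-]; rewrite l2_norm_inl0 l2_norm_inr0 l2_normE /=.
    by rewrite addr0 add0r.
- by apply: same_dimension_image => //; exact: (isometry_inj iso_inlY).
- by move=> x; split; [exact: Ns_inl | exact: l2_norm_inl0].
Qed.
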